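(* Let $N\in\mathbb N$, $\delta=1/N$. The flow defined on $\mathcal P^\delta_{>0}$ by the differential equation $$\dot\rho_\kappa=-2\,\Delta^\delta_\kappa\Big(\frac{\sqrt{\rho_+\rho_-}-\rho}{\delta^2}\Big)\qquad(\kappa\in[N])$$ is global (i.e. for each initial datum in $\mathcal P^\delta_{>0}$ there is a unique solution defined for all $t\ge0$ with values in $\mathcal P^\delta_{>0}$), and it possesses a unique continuous extension to a flow (continuous semigroup on $[0,\infty)$) on $\mathcal P^\delta$.
   Context: $[N]=\mathbb Z/N\mathbb Z$ with cyclic indices. For $f:[N]\to\mathbb R$: $(f_\pm)_\kappa=f_{\kappa\pm1}$ and $\Delta^\delta f=(f_++f_--2f)/\delta^2$, with value $\Delta^\delta_\kappa f$ at $\kappa$; products and square roots are componentwise. $\mathcal P^\delta=\{\rho:[N]\to\mathbb R:\rho_\kappa\ge0\ \forall\kappa,\ \delta\sum_\kappa\rho_\kappa=1\}$ and $\mathcal P^\delta_{>0}=\{\rho\in\mathcal P^\delta:\rho_\kappa>0\ \forall\kappa\}$, with the topology of $\mathbb R^N$. *)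

(* Defs.v *)
From HB Require Import structures.
From mathcomp Require Import all_boot all_order all_algebra.
From mathcomp Require Import all_classical all_reals all_analysis.

Set Implicit Arguments.
Unset Strict Implicit.
Unset Printing Implicit Defensive.

Import Order.TTheory GRing.Theory Num.Theory.
Import numFieldNormedType.Exports.

Local Open Scope classical_set_scope.
Local Open Scope ring_scope.

(* Functions [N] -> R are row vectors 'rV[R]_N, which carry the topology of
   R^N; the cyclic shifts of indices are ordS and ord_pred. *)

Definition shift_plus (R : realType) (N : nat) (f : 'rV[R]_N) : 'rV[R]_N :=
  \row_k f 0 (ordS k).

Definition shift_minus (R : realType) (N : nat) (f : 'rV[R]_N) : 'rV[R]_N :=
  \row_k f 0 (ord_pred k).

Definition mesh (R : realType) (N : nat) : R := N%:R^-1.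

Definition discrete_laplacian (R : realType) (N : nat) (delta : R)
    (f : 'rV[R]_N) : 'rV[R]_N :=
  (delta ^+ 2)^-1 *: (shift_plus f + shift_minus f - 2%:R *: f).

Definition sqrt_shifts (R : realType) (N : nat) (rho : 'rV[R]_N) : 'rV[R]_N :=
  \row_k Num.sqrt (shift_plus rho 0 k * shift_minus rho 0 k).

Definition flow_field (R : realType) (N : nat) (rho : 'rV[R]_N) : 'rV[R]_N :=
  - 2%:R *: discrete_laplacian (mesh R N)
    ((mesh R N ^+ 2)^-1 *: (sqrt_shifts rho - rho)).

Definition prob_densities (R : realType) (N : nat) : set 'rV[R]_N :=
  [set rho | (forall k, 0 <= rho 0 k) /\ mesh R N * \sum_k rho 0 k = 1].

Definition pos_prob_densities (R : realType) (N : nat) : set 'rV[R]_N :=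
  [set rho | prob_densities rho /\ forall k, 0 < rho 0 k].

(* Derivative relative to the half-line [0, +oo[: two-sided for t > 0,
   right derivative at t = 0. *)
Definition has_deriv_ge0 (R : realType) (f : R -> R) (t l : R) : Prop :=
  (f s - f t) / (s - t) @[s --> within [set s | 0 <= s] t^'] --> l.

(* Time is [0, +oo[; the values of u at negative times are irrelevant. *)
Definition is_solution (R : realType) (N : nat) (rho0 : 'rV[R]_N)
    (u : R -> 'rV[R]_N) : Prop :=
  [/\ u 0 = rho0,
      forall t : R, 0 <= t -> pos_prob_densities (u t)
    & forall (t : R) (k : 'I_N), 0 <= t ->
        has_deriv_ge0 (fun s => u s 0 k) t (flow_field (u t) 0 k)].

(* Only the restriction of S to [0, +oo[ x D is relevant; continuity is joint
   in time and initial datum, for the subspace topology. *)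
Definition continuous_semigroup (R : realType) (N : nat) (D : set 'rV[R]_N)
    (S : R -> 'rV[R]_N -> 'rV[R]_N) : Prop :=
  [/\ forall (t : R) (rho : 'rV[R]_N), 0 <= t -> D rho -> D (S t rho),
      forall rho : 'rV[R]_N, D rho -> S 0 rho = rho,
      forall (s t : R) (rho : 'rV[R]_N), 0 <= s -> 0 <= t -> D rho ->
        S (s + t) rho = S s (S t rho)
    & {within [set p : R * 'rV[R]_N | 0 <= p.1 /\ D p.2],
        continuous (fun p : R * 'rV[R]_N => S p.1 p.2)}].

Definition extends_flow (R : realType) (N : nat)
    (S : R -> 'rV[R]_N -> 'rV[R]_N) : Prop :=
  forall rho0 : 'rV[R]_N, pos_prob_densities rho0 ->
    is_solution rho0 (fun t => S t rho0).

(* Main.v *)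
Require Import Defs.
From HB Require Import structures.
From mathcomp Require Import all_boot all_order all_algebra.
From mathcomp Require Import all_classical all_reals all_analysis.
From mathcomp Require Import ring lra.
Import Order.TTheory GRing.Theory Num.Theory.
Import numFieldNormedType.Exports.
Local Open Scope classical_set_scope.
Local Open Scope ring_scope.

(** Write [a = sqrt rho] componentwise, [A = a_+ + a_-] for the sum of the two
    neighbours of [a], and [M] for the self-adjoint operator [a |-> A].  On
    nonnegative densities the vector field is
    [2 N^4 (A^2 - a M A)] ([flow_fieldE]), and three facts follow from this
    form by summation by parts on the cycle.

    - Mass: the components of the field sum to 0 ([sum_root_field]).

    - Entropy: the sum of [ln rho] does not decrease along the flow
      ([root_field_entropy]).  Since the mass is fixed, a very negative
      [ln rho_k] cannot be compensated by the other components, so that a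
      positive solution stays above a positive constant depending only on the
      initial datum.

    - Hellinger contraction: the affinity [sum sqrt rho sqrt eta] of two
      solutions does not decrease ([root_field_hellinger]), since its
      derivative is a sum of the squares [(A b - B a)^2 / (a b)].

    Global existence ([positive_solution]).  The square roots are evaluated at
    [rho] clipped to an interval [[m, N]] with [m > 0], which makes the field
    bounded and globally Lipschitz; the Picard iterates then converge on the
    whole half-line ([picard_lindelof]).  The truncated problem has its own
    entropy, in which [ln] is replaced by the function with derivative
    [1 / clip] ([truncated_log]).  It is monotone whether or not the clipping
    is active, and it implies [rho >= m] when [m] is small enough, so that the
    clipping was never active.

    Uniqueness and extension.  The contraction of the Hellinger distance gives
    [|u_k - v_k| <= 2 N sqrt (sup |rho0 - eta0|)] for two solutions at the same
    time ([solution_dist]).  This is uniqueness, and also a modulus of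
    continuity with respect to the initial datum which is uniform in time and
    does not degenerate at the boundary.  As solutions are also uniformly
    Lipschitz in time ([solution_lipschitz]), the flow extends to all
    densities as the limit along the positive blends of the datum with the
    uniform density ([flow_extension]).  The semigroup law and the uniqueness
    of the extension are identities between continuous maps that hold on the
    dense set of positive densities ([dense_eq]). *)

Set Implicit Arguments.
Unset Strict Implicit.

(** * The vector field in terms of square roots *)

Definition nbr_sum (R : realType) (N : nat) (a : 'I_N -> R) (k : 'I_N) : R :=
  a (ordS k) + a (ord_pred k).

(** With [a] the square root of a density, the flow field up to the factor
    [2 N^4]. *)
Definition root_field (R : realType) (N : nat) (a : 'I_N -> R) (k : 'I_N) : R :=
  nbr_sum a k ^+ 2 - a k * nbr_sum (nbr_sum a) k.

Lemma sum_ordS (R : realType) (N : nat) (f : 'I_N -> R) :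
  \sum_k f (ordS k) = \sum_k f k.
Proof. by rewrite [RHS](reindex_inj (can_inj (@ordSK N))). Qed.

Lemma sum_ord_pred (R : realType) (N : nat) (f : 'I_N -> R) :
  \sum_k f (ord_pred k) = \sum_k f k.
Proof. by rewrite [RHS](reindex_inj (can_inj (@ord_predK N))). Qed.

Lemma nbr_sum_adj (R : realType) (N : nat) (f g : 'I_N -> R) :
  \sum_k f k * nbr_sum g k = \sum_k nbr_sum f k * g k.
Proof.
under eq_bigr do rewrite mulrDr.
under [RHS]eq_bigr do rewrite mulrDl.
rewrite !big_split/= addrC -[X in X + _]sum_ordS -[X in _ + X]sum_ord_pred.
by congr (_ + _); apply: eq_bigr => k _; rewrite ?ordSK ?ord_predK.
Qed.

Lemma sum_root_field (R : realType) (N : nat) (a : 'I_N -> R) :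
  \sum_k root_field a k = 0.
Proof.
rewrite /root_field big_split/= sumrN (nbr_sum_adj a) -sumrN -big_split big1//=.
move=> k _.
by ring.
Qed.

(** The second difference of [sqrt (rho_+ rho_-) - rho] is
    [a M A - A^2], where [a = sqrt rho] and [A = M a]. *)
Lemma flow_fieldE (R : realType) (N : nat) (rho : 'rV[R]_N) k :
  (forall k, 0 <= rho 0 k) ->
  flow_field rho 0 k =
    2 * N%:R ^+ 4 * root_field (fun k => Num.sqrt (rho 0 k)) k.
Proof.
move=> rho0; rewrite /flow_field /discrete_laplacian /sqrt_shifts.
rewrite /shift_plus /shift_minus /mesh !mxE !ord_predK !ordSK.
rewrite !sqrtrM// /root_field /nbr_sum ord_predK ordSK -!exprVn invrK.
rewrite -[in LHS](sqr_sqrtr (rho0 k)) -[in LHS](sqr_sqrtr (rho0 (ordS k))).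
rewrite -[in LHS](sqr_sqrtr (rho0 (ord_pred k))).
rewrite !sqrtr_sqr !ger0_norm ?sqrtr_ge0//.
by ring.
Qed.

(** Up to a positive factor, the sum is the time derivative of the affinity
    [sum a b].  Because [M] is self-adjoint, [sum (b M A + a M B)] equals
    [2 sum A B], which completes the square. *)
Lemma root_field_hellinger (R : realType) (N : nat) (a b : 'I_N -> R) :
  (forall k, 0 < a k) -> (forall k, 0 < b k) ->
  0 <= \sum_k (root_field a k / a k * b k + root_field b k / b k * a k).
Proof.
move=> a0 b0.
have -> : \sum_k (root_field a k / a k * b k + root_field b k / b k * a k) =
    \sum_k (nbr_sum a k * b k - nbr_sum b k * a k) ^+ 2 / (a k * b k).
  transitivity (\sum_k (nbr_sum a k ^+ 2 / a k * b k +
        nbr_sum b k ^+ 2 / b k * a k) -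
      \sum_k (b k * nbr_sum (nbr_sum a) k) -
      \sum_k (a k * nbr_sum (nbr_sum b) k)).
    rewrite -!sumrN -!big_split/=; apply: eq_bigr => k _; rewrite /root_field.
    by field; rewrite !gt_eqF.
  rewrite (nbr_sum_adj a) (nbr_sum_adj b) -!sumrN -!big_split/=.
  apply: eq_bigr => k _.
  by field; rewrite !gt_eqF.
by apply: sumr_ge0 => k _; rewrite divr_ge0 ?sqr_ge0 ?mulr_ge0 ?ltW.
Qed.

Lemma ln_le_subr1 (R : realType) (x : R) : 0 < x -> ln x <= x - 1.
Proof.
by move=> x0; have := @le_ln1Dx R (x - 1); rewrite subrKC; apply; lra.
Qed.

(** With the ratios [p_k = a_{k+1} / a_k] and [q_k = a_{k-1} / a_k], summation
    by parts splits the sum into [sum p_k (p_k - p_{k-1})] and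
    [sum q_k (q_k - q_{k+1})], both nonnegative by rearrangement on the cycle,
    and [2 sum (p_k q_k - 1)], which is bounded below by
    [2 sum (ln p_k + ln q_k) = 0]. *)
Lemma root_field_entropy (R : realType) (N : nat) (a : 'I_N -> R) :
  (forall k, 0 < a k) -> 0 <= \sum_k root_field a k / a k ^+ 2.
Proof.
move=> a0; have an k : a k != 0 by rewrite gt_eqF.
pose p k := a (ordS k) / a k; pose q k := a (ord_pred k) / a k.
have -> : \sum_k root_field a k / a k ^+ 2 =
    \sum_k (p k ^+ 2 - p k * p (ord_pred k)) +
    \sum_k (q k ^+ 2 - q k * q (ordS k)) + 2 * \sum_k (p k * q k - 1).
  transitivity (\sum_k nbr_sum a k ^+ 2 / a k ^+ 2 -
      \sum_k (a k)^-1 * nbr_sum (nbr_sum a) k).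
    rewrite -sumrN -!big_split/=; apply: eq_bigr => k _; rewrite /root_field.
    by field.
  rewrite (nbr_sum_adj (fun k => (a k)^-1)) mulr_sumr -sumrN -!big_split/=.
  apply: eq_bigr => k _.
  by rewrite /p /q /nbr_sum ord_predK ordSK; field; rewrite !an.
have sq_ge (f : 'I_N -> R) g : \sum_k f (g k) ^+ 2 = \sum_k f k ^+ 2 ->
    0 <= \sum_k (f k ^+ 2 - f k * f (g k)).
  move=> fg; rewrite -(pmulr_rge0 _ (ltr0Sn R 1)) mulr_sumr.
  have -> : \sum_k 2 * (f k ^+ 2 - f k * f (g k)) =
      \sum_k ((f k - f (g k)) ^+ 2 + f k ^+ 2 - f (g k) ^+ 2).
    by apply: eq_bigr => k _; ring.
  rewrite !big_split/= sumrN fg addrK.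
  by apply: sumr_ge0 => k _; exact: sqr_ge0.
rewrite !addr_ge0 ?mulr_ge0 ?ler0n//.
- by apply: sq_ge; rewrite (sum_ord_pred (fun k => p k ^+ 2)).
- by apply: sq_ge; rewrite (sum_ordS (fun k => q k ^+ 2)).
have ln0 : \sum_k (ln (a (ordS k)) + ln (a (ord_pred k)) - 2 * ln (a k)) = 0.
  rewrite !big_split/= (sum_ordS (fun k => ln (a k))).
  by rewrite (sum_ord_pred (fun k => ln (a k))) sumrN -mulr_sumr/=; ring.
rewrite -[leLHS]ln0.
apply: ler_sum => k _; rewrite /p /q.
apply: le_trans (ln_le_subr1 _); last by rewrite !mulr_gt0 ?invr_gt0.
rewrite !lnM ?posrE ?mulr_gt0 ?invr_gt0// !lnV ?posrE//.
by lra.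
Qed.

(** * Derivatives on a half-line *)

Lemma is_derive_slopeP (R : realType) (f : R -> R) (t l : R) :
  is_derive t 1 f l <-> (f s - f t) / (s - t) @[s --> t^'] --> l.
Proof.
have slopeP : (f s - f t) / (s - t) @[s --> t^'] --> l <->
    h^-1 *: ((f \o shift t) (h *: 1) - f t) @[h --> 0^'] --> l.
  split=> /cvgrPdist_lt fl; apply/cvgrPdist_lt => e e0; move: (fl e e0).
  - move=> /nbhs_ballP[d /= d0 H]; apply/nbhs_ballP; exists d => //= h.
    rewrite /ball/= sub0r normrN => hd h0; have := H (h + t).
    have -> : ball t d (h + t) = (`|h| < d) :> Prop.
      by rewrite /ball/= opprD addrC subrK normrN.
    move=> /(_ hd).
    rewrite /shift/= scaler1 addrK [_^-1 *: _]mulrC; apply.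
    by apply: contra_neq h0 => ?; lra.
  - move=> /nbhs_ballP[d /= d0 H]; apply/nbhs_ballP; exists d => //= s.
    rewrite /ball/= => sd st; have := H (s - t).
    rewrite /ball/= sub0r normrN distrC => /(_ sd).
    by rewrite /shift/= scaler1 subrK [_^-1 *: _]mulrC; apply; rewrite subr_eq0.
rewrite slopeP; split=> [[cf df]|fl]; first by rewrite -df; exact: cf.
by split; [exact: cvgP fl|exact: cvg_lim fl].
Qed.

Lemma has_deriv_ge0W (R : realType) (f : R -> R) (t l : R) :
  is_derive t 1 f l -> has_deriv_ge0 f t l.
Proof.
move=> /is_derive_slopeP; apply: cvg_trans; apply: cvg_app; exact: cvg_within.
Qed.

Lemma has_deriv_ge0_eq (R : realType) (f g : R -> R) (t l : R) : 0 <= t ->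
  (forall s, 0 <= s -> f s = g s) -> has_deriv_ge0 f t l -> has_deriv_ge0 g t l.
Proof.
move=> t0 fg; apply: cvg_trans; apply: fmap_within_eq => s; rewrite inE/= => s0.
by rewrite !fg.
Qed.

(** A function with a one-sided derivative at 0 becomes two-sided
    differentiable there when continued affinely to negative times; thus the
    usual differential calculus applies to solutions at every [t >= 0]. *)
Lemma has_deriv_ge0_extend (R : realType) (f g : R -> R) :
  (forall t, 0 <= t -> has_deriv_ge0 f t (g t)) ->
  exists F : R -> R, forall t, 0 <= t -> F t = f t /\ is_derive t 1 F (g t).
Proof.
move=> fg; exists (fun t => if 0 <= t then f t else f 0 + g 0 * t).
move=> t t0; split; first by rewrite t0.
apply/is_derive_slopeP/cvgrPdist_lt => e e0.
have /cvgrPdist_lt/(_ e e0) := fg t t0.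
move=> /nbhs_ballP[d /= d0 H]; apply/nbhs_ballP.
have [t_eq0|tn0] := eqVneq t 0; first (subst t).
  exists d => //= s; rewrite /ball/= lexx.
  case: ifPn => [s0 sd sn|]; first exact: H.
  rewrite -ltNge => s0 _ sn0; rewrite addrAC subrr add0r subr0 mulfK//.
  by rewrite subrr normr0.
have {}t0 : 0 < t by rewrite lt_neqAle eq_sym tn0.
exists (Num.min d t) => [|s]; first by rewrite /= lt_min d0/=.
rewrite /ball/= lt_min => /andP[sd st]; rewrite (ltW t0).
have s0 : 0 <= s by move: st; rewrite ltr_norml; lra.
by rewrite s0; move=> sn; apply: H.
Qed.

Lemma is_derive_continuous (R : realType) (f : R -> R) (t l : R) :
  is_derive t 1 f l -> {for t, continuous f}.
Proof.
by case=> df _; apply: differentiable_continuous; exact/derivable1_diffP.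
Qed.

Lemma ge0_is_derive_le (R : realType) (f f' : R -> R) (s t : R) : s <= t ->
  (forall x, s <= x <= t -> is_derive x 1 f (f' x)) ->
  (forall x, s < x < t -> 0 <= f' x) -> f s <= f t.
Proof.
move=> st df f'0.
have ooW x : x \in `]s, t[ -> s <= x <= t.
  by rewrite in_itv/= => /andP[/ltW -> /ltW ->].
apply: (@ger0_derive1_ndecr _ f s t) => // x.
- by move=> /ooW/df[].
- by move=> sxt; rewrite derive1E; have [_ ->] := df x (ooW _ sxt); exact: f'0.
- apply: derivable_within_continuous => {}x; rewrite in_itv/= => sxt.
  by case: (df x sxt).
Qed.

Lemma is_derive_0_eq (R : realType) (f : R -> R) (s t : R) : s <= t ->
  (forall x, s <= x <= t -> is_derive x 1 f 0) -> f s = f t.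
Proof.
move=> st df; apply/eqP; rewrite eq_le (ge0_is_derive_le st df)//=.
rewrite -lerN2; apply: (@ge0_is_derive_le _ (- f) (fun=> 0) s t st) => // x sxt.
by have := df x sxt => ?; rewrite -[0]oppr0; exact: is_deriveN.
Qed.

(** Both [h - f] and [h + f] are nondecreasing. *)
Lemma is_derive_dominated (R : realType) (f f' h h' : R -> R) (a : R) :
  (forall t, a <= t -> is_derive t 1 f (f' t)) ->
  (forall t, a <= t -> is_derive t 1 h (h' t)) ->
  (forall t, a < t -> `|f' t| <= h' t) -> `|f a| <= h a ->
  forall t, a <= t -> `|f t| <= h t.
Proof.
move=> df dh fh fha t at_.
have mono (c : R) : `|c| = 1 -> c * f t <= h t.
  move=> c1; rewrite -subr_ge0; apply: le_trans (_ : (h - c \*: f) a <= _).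
    rewrite subr_ge0 /= (le_trans _ fha)// (le_trans (ler_norm _))//.
    by rewrite normrM c1 mul1r.
  apply: (@ge0_is_derive_le _ _ (fun t => h' t - c * f' t)) at_ _ _.
    move=> x /andP[ax _].
    by have := df _ ax; have := dh _ ax => ? ?; exact: is_deriveB.
  move=> x /andP[ax _]; rewrite subr_ge0 (le_trans _ (fh _ ax))//.
  by rewrite (le_trans (ler_norm _))// normrM c1 mul1r.
have := mono 1; have := mono (-1); rewrite normrN normr1 ler_norml.
by move=> /(_ erefl) ? /(_ erefl) ?; apply/andP; split; lra.
Qed.

Lemma antiderivative (R : realType) (f : R -> R) (a c : R) :
  continuous f -> a < c ->
  exists F : R -> R, F c = 0 /\ forall t, a < t -> is_derive t 1 F (f t).
Proof.
move=> cf ac; pose F x := (\int[lebesgue_measure]_(t in `[a, x]) f t)%R.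
have dF t : a < t -> is_derive t 1 F (f t).
  move=> at_; have fint : lebesgue_measure.-integrable `[a, t + 1] (EFin \o f).
    apply: continuous_compact_integrable; first exact: segment_compact.
    by apply: continuous_subspaceT => x; exact: cf.
  have t1 : t < t + 1 by rewrite ltrDl.
  have [dF F'] := continuous_FTC1_closed t1 fint at_ (cf t).
  by rewrite derive1E in F'; exact: DeriveDef dF F'.
exists (F - cst (F c)); split=> [|t at_]; first by rewrite fctE subrr.
by rewrite -[f t]subr0; have := dF t at_ => ?; exact: is_deriveB.
Qed.

Lemma cauchy_rate (R : realType) (x e : nat -> R) :
  e @ \oo --> 0 -> (forall n m, (n <= m)%N -> `|x m - x n| <= e n) ->
  exists l, forall n, `|l - x n| <= e n.
Proof.
move=> e0 xe.
have cx : cvgn x.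
  apply/cauchy_cvgP/cauchy_ballP => d d0.
  have /cvgrPdist_lt/(_ (d / 2)) := e0; rewrite divr_gt0// => /(_ isT)[n _ en].
  exists (x @` [set m | (n <= m)%N], x @` [set m | (n <= m)%N]) => /=.
    by split; exists n => // m nm; exists m.
  have en' := en n (leqnn n); rewrite sub0r normrN in en'.
  move=> [_ _] [[m nm <-] [p np <-]]; rewrite /ball/=.
  have := xe _ _ nm; have := xe _ _ np; have := ler_norm (e n).
  by move: en'; rewrite !ltr_norml !ler_norml; lra.
exists (limn x) => n.
have dist_cv : (fun m => `|x m - x n|) @ \oo --> `|limn x - x n|.
  by apply: cvg_norm; apply: cvgB => //; exact: cvg_cst.
rewrite -(cvg_lim _ dist_cv)//; apply: limr_le; first exact: cvgP dist_cv.
by exists n => // m nm; exact: xe.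
Qed.

(** * Global solutions of Lipschitz differential equations *)

(** Lipschitz continuity for the supremum norm of the components. *)
Definition sup_lipschitz (R : realType) (N : nat) (L : R)
    (G : ('I_N -> R) -> 'I_N -> R) :=
  forall x y e, (forall k, `|x k - y k| <= e) ->
    forall k, `|G x k - G y k| <= L * e.

Lemma continuous_sup_lipschitz (R : realType) (N : nat) (L : R)
    (G : ('I_N -> R) -> 'I_N -> R) (u : R -> 'I_N -> R) : 0 < L ->
  sup_lipschitz L G -> (forall k, continuous (u^~ k)) ->
  forall k, continuous (fun s => G (u s) k).
Proof.
move=> L0 GL cu k t; apply/cvgrPdist_le => e e0.
have near_u : \forall s \near t, forall j, `|u t j - u s j| <= L^-1 * e.
  have near_uj j : \forall s \near t, `|u t j - u s j| <= L^-1 * e.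
    by have /cvgrPdist_le := cu j t; apply; rewrite mulr_gt0 ?invr_gt0.
  exact: filter_forall near_uj.
near=> s; have := near near_u s.
by move=> /(_ _) ust; rewrite (le_trans (GL _ _ _ (ust _) k))// mulVKf ?gt_eqF.
Unshelve. all: by end_near. Qed.

Lemma small_geometric (R : realType) (C e : R) : 0 < e ->
  exists n, C * 2^-1 ^+ n < e.
Proof.
move=> e0; have half1 : `|2^-1 : R| < 1 by rewrite ger0_norm// invf_lt1// ltr1n.
have /cvgrPdist_lt/(_ e e0)[n _ /(_ n (leqnn n))] := cvg_geometric C half1.
rewrite sub0r normrN => Cn; exists n; exact: le_lt_trans (ler_norm _) Cn.
Qed.

(** Successive Picard iterates differ by at most
    [B 2^-n exp (2 L t)]: this weight is reproduced, with a factor 1/2, when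
    it is multiplied by [L] and integrated, so that the iterates converge on
    the whole half-line at once and solutions on short intervals need not be
    glued together. *)
Lemma picard_lindelof (R : realType) (N : nat) (L : R)
    (G : ('I_N -> R) -> 'I_N -> R) (x0 : 'I_N -> R) :
  0 < L -> sup_lipschitz L G ->
  exists u : R -> 'I_N -> R, u 0 = x0 /\
    forall (t : R) k, 0 <= t -> is_derive t 1 (u^~ k) (G (u t) k).
Proof.
move=> L0 GL.
(* Extending a trajectory to negative times by its value at 0 makes continuity
   on the half-line a statement about functions on the whole line. *)
pose good (u : R -> 'I_N -> R) :=
  forall k, continuous (fun s : R => u (Num.max s 0) k).
pose step (u w : R -> 'I_N -> R) := [/\ good w, w 0 = x0 &
  forall (t : R) k, 0 <= t -> is_derive t 1 (w^~ k) (G (u t) k)].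
have cmax : continuous (fun s : R => Num.max s 0).
  by move=> s; apply: continuous_max => //; exact: cst_continuous.
have /choice[T stepT] : forall u, exists w, good u -> step u w.
  move=> u; have [gu|] := pselect (good u); last by exists u.
  have Gu (k : 'I_N) : exists F : R -> R, F 0 = 0 /\
      forall t : R, -1 < t -> is_derive t 1 F (G (u (Num.max t 0)) k).
    apply: antiderivative; last by rewrite ltrN10.
    exact: (continuous_sup_lipschitz L0 GL gu).
  have [F FP] := choice Gu.
  have dF (t : R) k : 0 <= t ->
      is_derive t 1 (fun s => x0 k + F k s) (G (u t) k).
    move=> t0; have [_ dFk] := FP k; have := dFk t (lt_le_trans (ltrN10 R) t0).
    by rewrite max_l// => ?; rewrite -[G _ _]add0r; exact: is_deriveD.
  exists (fun t k => x0 k + F k t) => _; split=> //.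
  - move=> k s; have s0 : 0 <= Num.max s 0 by rewrite le_max lexx orbT.
    exact: (continuous_comp (cmax s) (is_derive_continuous (dF _ k s0))).
  - by apply/funext => k; have [-> _] := FP k; rewrite addr0.
pose U := fix U n := if n is n.+1 then T (U n) else fun=> x0.
have gU n : good (U n).
  elim: n => [k|n /stepT[]//]; exact: cst_continuous.
have U0 n : U n 0 = x0 by case: n => //= n; have [] := stepT _ (gU n).
have dU n (t : R) k : 0 <= t -> is_derive t 1 ((U n.+1)^~ k) (G (U n t) k).
  by move=> t0; have [_ _] := stepT _ (gU n); exact.
pose B := (2 * L)^-1 * \sum_k `|G x0 k|.
have B0 : 0 <= B by rewrite mulr_ge0 ?sumr_ge0// invr_ge0 mulr_ge0// ltW.
pose E t := expR (2 * L * t).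
have dE (c t : R) : is_derive t 1 (fun s => c * E s) (c * (2 * L * E t)).
  have dlin : is_derive t 1 (fun s : R => 2 * L * s) (2 * L).
    have := is_deriveZ (2 * L) (is_derive_id t (1 : R)).
    by rewrite [_ *: _]mulr1.
  by rewrite [2 * L * E t]mulrC; apply: is_deriveZ; exact: is_derive1_comp.
have E0 t : 0 < E t by exact: expR_gt0.
have half n : 0 < 2^-1 ^+ n :> R by rewrite exprn_gt0// invr_gt0.
have dist n (t : R) k : 0 <= t ->
    `|U n.+1 t k - U n t k| <= B * 2^-1 ^+ n * E t.
  elim: n t k => [|n IH] t k.
    apply: (@is_derive_dominated _ (fun t => U 1 t k - U 0 t k) (fun=> G x0 k)
      (fun t => B * 2^-1 ^+ 0 * E t) _ 0 _ (fun t _ => dE _ t)).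
    - move=> s s0; rewrite -[G x0 k]subr0.
      exact: is_deriveB (dU 0 s k s0) (is_derive_cst (x0 k) s 1).
    - move=> s s0.
      have -> : B * 2^-1 ^+ 0 * (2 * L * E s) = (\sum_k `|G x0 k|) * E s.
        by rewrite /B; field; rewrite gt_eqF.
      have E1 : 1 <= E s by rewrite -expR0 ler_expR mulr_ge0 ?mulr_ge0// ltW.
      have Gk : `|G x0 k| <= \sum_j `|G x0 j|.
        by rewrite (bigD1 k)//= lerDl sumr_ge0.
      apply: le_trans Gk _; rewrite -[leLHS]mulr1 ler_wpM2l//.
      exact: sumr_ge0.
    - rewrite U0 subrr normr0; apply: mulr_ge0; last exact: ltW.
      exact: mulr_ge0 (ltW (half 0)).
  apply: (@is_derive_dominated _ (fun t => U n.+2 t k - U n.+1 t k)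
    (fun t => G (U n.+1 t) k - G (U n t) k)
    (fun t => B * 2^-1 ^+ n.+1 * E t) _ 0 _ (fun t _ => dE _ t)).
  - move=> s s0; have := dU n s k s0; have := dU n.+1 s k s0 => ? ?.
    exact: is_deriveB.
  - move=> s s0; rewrite (le_trans (GL _ _ _ (fun k => IH s k (ltW s0)) k))//.
    by rewrite exprS le_eqVlt; apply/orP; left; apply/eqP; field.
  - rewrite !U0 subrr normr0; apply: mulr_ge0; last exact: ltW.
    exact: mulr_ge0 (ltW (half _)).
have distm n m (t : R) k : 0 <= t -> (n <= m)%N ->
    `|U m t k - U n t k| <= 2 * B * E t * 2^-1 ^+ n.
  move=> t0 nm; apply: (@le_trans _ _ (2 * B * E t * (2^-1 ^+ n - 2^-1 ^+ m))).
    elim: m nm => [|m IH].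
      by rewrite leqn0 => /eqP ->; rewrite !subrr normr0 mulr0.
    rewrite leq_eqVlt => /predU1P[->|]; first by rewrite !subrr normr0 mulr0.
    rewrite ltnS => /IH{}IH; rewrite (le_trans (ler_distD (U m t k) _ _))//.
    rewrite (le_trans (lerD (dist _ _ _ t0) IH))// exprS.
    by rewrite le_eqVlt; apply/orP; left; apply/eqP; field.
  apply: ler_wpM2l; last by rewrite gerBl ltW.
  by apply: mulr_ge0; [exact: mulr_ge0|exact: ltW].
have lim_ex (tk : R * 'I_N) : exists l, 0 <= tk.1 ->
    forall n, `|l - U n tk.1 tk.2| <= 2 * B * E tk.1 * 2^-1 ^+ n.
  case: tk => t k /=; have [t0|t0] := leP 0 t; last by exists 0; lra.
  have [|n m|l lP] := @cauchy_rate _ (fun n => U n t k)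
    (fun n => 2 * B * E t * 2^-1 ^+ n).
  - by apply: cvg_geometric; rewrite ger0_norm ?invr_ge0// invf_lt1// ltr1n.
  - exact: distm.
  - by exists l.
have [l lP] := choice lim_ex; pose u t k := l (t, k).
have uP n (t : R) k : 0 <= t -> `|u t k - U n t k| <= 2 * B * E t * 2^-1 ^+ n.
  by move=> t0; exact: (lP (t, k) t0).
have good_u : good u.
  move=> k t; apply/cvgrPdist_lt => e e0.
  pose t1 := Num.max t 0 + 1.
  have e3 : 0 < e / 3 by rewrite divr_gt0.
  have [n Mn] := small_geometric (2 * B * E t1) e3.
  (* The convergence is uniform on [0, t1]. *)
  have unif r : 0 <= r -> r <= t1 -> `|u r k - U n r k| < e / 3.
    move=> r0 rt; rewrite (le_lt_trans (uP n r k r0))// (le_lt_trans _ Mn)//.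
    rewrite ler_pM2r//; apply: ler_wpM2l; first exact: mulr_ge0.
    by rewrite ler_expR; apply: ler_wpM2l => //; rewrite mulr_ge0// ltW.
  have t0 : 0 <= Num.max t 0 by rewrite le_max lexx orbT.
  near=> s; have s0 : 0 <= Num.max s 0 by rewrite le_max lexx orbT.
  have tt1 : Num.max t 0 <= t1 by rewrite lerDl.
  have st1 : Num.max s 0 <= t1.
    have st : s <= t + 1 by apply: ltW; near: s; apply: lt_nbhsl; rewrite ltrDl.
    have tt : t <= Num.max t 0 by rewrite le_max lexx.
    rewrite ge_max (le_trans t0 tt1) andbT (le_trans st)//.
    by rewrite /t1 lerD2r.
  have := unif _ t0 tt1; have := unif _ s0 st1.
  have : `|U n (Num.max t 0) k - U n (Num.max s 0) k| < e / 3.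
    by near: s; have /cvgrPdist_lt := gU n k t; apply.
  rewrite !ltr_norml; lra.
(* One more Picard step leaves the limit unchanged for t >= 0. *)
have [_ w0 dw] := stepT _ good_u.
exists (T u).
have wu (t : R) : 0 <= t -> T u t = u t.
  move=> t0; apply/funext => k; apply/eqP; rewrite -subr_eq0 -normr_le0.
  have bound (n : nat) : `|T u t k - u t k| <= 2 * B * E t * 2^-1 ^+ n.
    have wU : `|T u t k - U n.+1 t k| <= B * 2^-1 ^+ n * E t.
      apply: (@is_derive_dominated _ (fun t => T u t k - U n.+1 t k)
        (fun t => G (u t) k - G (U n t) k)
        (fun t => B * 2^-1 ^+ n * E t) _ 0 _ (fun t _ => dE _ t)) t0.
      - move=> s s0; have := dU n s k s0; have := dw s k s0 => ? ?.
        exact: is_deriveB.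
      - move=> s s0.
        rewrite (le_trans (GL _ _ _ (fun k => uP n s k (ltW s0)) k))//.
        by rewrite le_eqVlt; apply/orP; left; apply/eqP; ring.
      - rewrite w0 U0 subrr normr0; apply: mulr_ge0; last exact: ltW.
        exact: mulr_ge0 (ltW (half _)).
    rewrite (le_trans (ler_distD (U n.+1 t k) _ _))//.
    rewrite [X in _ + X]distrC (le_trans (lerD wU (uP n.+1 t k t0)))// exprS.
    by rewrite le_eqVlt; apply/orP; left; apply/eqP; field.
  rewrite leNgt; apply/negP => wu0.
  by have [n] := small_geometric (2 * B * E t) wu0; rewrite ltNge bound.
split=> // t k t0; rewrite (wu t)//; exact: dw.
Unshelve. all: by end_near. Qed.

(** * Truncation *)

Definition clip (R : realType) (m M x : R) : R := Num.max m (Num.min x M).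

Lemma ge_clip (R : realType) (m M x : R) : m <= clip m M x.
Proof. by rewrite le_max lexx. Qed.

Lemma clip_le (R : realType) (m M x : R) : m <= M -> clip m M x <= M.
Proof. by move=> mM; rewrite ge_max mM ge_min lexx orbT. Qed.

Lemma clip_id (R : realType) (m M x : R) : m <= x <= M -> clip m M x = x.
Proof. by move=> /andP[mx xM]; rewrite /clip min_l// max_r. Qed.

Lemma clip_dist (R : realType) (m M x y : R) :
  `|clip m M x - clip m M y| <= `|x - y|.
Proof.
have xy := ler_norm (x - y); have yx := ler_norm (y - x); rewrite distrC in yx.
rewrite /clip ler_norml.
case: (leP x M) => ?; case: (leP y M) => ?;
  do 2?[case: (leP m _) => ?]; by apply/andP; split; lra.
Qed.

Lemma continuous_clip (R : realType) (m M : R) : continuous (clip m M).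
Proof.
move=> x; apply/cvgrPdist_le => e e0.
near=> y; apply: le_trans (clip_dist _ _ _ _) _; near: y.
exact: cvgr_dist_le.
Unshelve. all: by end_near. Qed.

(** The entropy density of the truncated equation: the antiderivative of
    [1 / clip] is [ln] on [[m, M]] and is continued by its tangents outside, so
    it inherits the bound by [x - 1] from concavity.  The number
    [a] is the lower limit of integration; it is chosen below all the values
    at which [phi] is evaluated. *)
Lemma truncated_log (R : realType) (m M a : R) :
  0 < m -> m <= 1 -> 1 <= M -> a < m ->
  exists phi : R -> R,
    [/\ forall x, a < x -> is_derive x 1 phi (clip m M x)^-1,
        forall x, m <= x <= M -> phi x = ln x,
        forall x, a < x -> phi x <= x - 1
      & forall x, a < x -> x <= m -> phi x <= ln m + x - m].
Proof.
move=> m0 m1 M1 am; have a1 : a < 1 := lt_le_trans am m1.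
have mM := le_trans m1 M1.
have clip0 x : 0 < clip m M x by rewrite (lt_le_trans m0)// ge_clip.
have cV : continuous (fun x => (clip m M x)^-1).
  by move=> x; apply: continuousV; [rewrite gt_eqF|exact: continuous_clip].
have [phi [phi1 dphi]] := antiderivative cV a1.
have dphiB x : a < x ->
    is_derive x 1 (fun x => phi x - x) ((clip m M x)^-1 - 1).
  by move=> ax; exact: is_deriveB (dphi x ax) (is_derive_id x 1).
have clip_le1 x : x <= 1 -> clip m M x <= 1 by rewrite ge_max m1 ge_min => ->.
have clip_ge1 x : 1 <= x -> 1 <= clip m M x.
  by rewrite le_max le_min M1 andbT => ->; rewrite orbT.
have phiB_ndecr x y : a < x -> x <= y -> y <= 1 -> phi x - x <= phi y - y.
  move=> ax xy y1.
  apply: (@ge0_is_derive_le _ (fun x => phi x - x) _ x y xy) => z /andP[xz zy].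
    exact: dphiB (lt_le_trans ax xz).
  by rewrite subr_ge0 invf_ge1// clip_le1// (le_trans (ltW zy)).
have phi_ln x : m <= x <= M -> phi x = ln x.
  have dB y : m <= y <= M -> is_derive y 1 (fun y => phi y - ln y) 0.
    move=> myM; have y0 : 0 < y by case/andP: myM => /(lt_le_trans m0).
    have ay : a < y by case/andP: myM => /(lt_le_trans am).
    have := dphi y ay; rewrite clip_id// => dphiy.
    by rewrite -(subrr y^-1); exact: is_deriveB dphiy (is_derive1_ln y0).
  move=> mxM; suff : phi x - ln x = phi 1 - ln 1 by rewrite phi1 ln1; lra.
  have [x1|/ltW x1] := leP x 1.
    apply: (@is_derive_0_eq _ (fun y => phi y - ln y)) x1 _ => y xy.
    by apply: dB; lra.
  apply/esym; apply: (@is_derive_0_eq _ (fun y => phi y - ln y)) x1 _ => y xy.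
  by apply: dB; lra.
exists phi; split; [exact: dphi|exact: phi_ln| |].
- move=> x ax; have [x1|/ltW x1] := leP x 1.
    by have := phiB_ndecr _ _ ax x1 (lexx 1); rewrite phi1; lra.
  suff : 1 - phi 1 <= x - phi x by rewrite phi1; lra.
  apply: (@ge0_is_derive_le _ (fun x => x - phi x)
    (fun x => 1 - (clip m M x)^-1)) x1 _ _ => z /andP[xz zx].
    exact: is_deriveB (is_derive_id z 1) (dphi z (lt_le_trans a1 xz)).
  by rewrite subr_ge0 invf_le1// clip_ge1// ltW.
- move=> x ax xm; rewrite -phi_ln ?lexx//; have := phiB_ndecr _ _ ax xm m1; lra.
Qed.

(** Boundedness is part of the notion because it makes the class stable
    under products. *)
Definition bounded_lipschitz (R : realType) (N : nat)
    (g : ('I_N -> R) -> R) : Prop :=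
  exists B L : R, [/\ 0 <= B, 0 <= L, forall x, `|g x| <= B &
    forall x y e, (forall k, `|x k - y k| <= e) -> `|g x - g y| <= L * e].

Lemma bounded_lipschitzD (R : realType) (N : nat) (f g : ('I_N -> R) -> R) :
  bounded_lipschitz f -> bounded_lipschitz g ->
  bounded_lipschitz (fun x => f x + g x).
Proof.
move=> [B [L [B0 L0 fB fL]]] [B' [L' [B'0 L'0 gB gL]]].
exists (B + B'), (L + L'); split; [exact: addr_ge0|exact: addr_ge0| |].
  by move=> x; rewrite (le_trans (ler_normD _ _))// lerD.
move=> x y e xy; rewrite opprD addrACA (le_trans (ler_normD _ _))//.
by rewrite mulrDl lerD// ?fL ?gL.
Qed.

Lemma bounded_lipschitzM (R : realType) (N : nat) (f g : ('I_N -> R) -> R) :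
  bounded_lipschitz f -> bounded_lipschitz g ->
  bounded_lipschitz (fun x => f x * g x).
Proof.
move=> [B [L [B0 L0 fB fL]]] [B' [L' [B'0 L'0 gB gL]]].
exists (B * B'), (B * L' + B' * L); split.
- exact: mulr_ge0.
- by rewrite addr_ge0// mulr_ge0.
- by move=> x; rewrite normrM ler_pM.
move=> x y e xy.
have -> : f x * g x - f y * g y = f x * (g x - g y) + g y * (f x - f y) by ring.
rewrite (le_trans (ler_normD _ _))// mulrDl lerD// normrM -mulrA ler_pM//.
  exact: gL.
exact: fL.
Qed.

Lemma bounded_lipschitz_cst (R : realType) (N : nat) (c : R) :
  bounded_lipschitz (fun _ : 'I_N -> R => c).
Proof.
exists `|c|, 0; split=> // x y e xy.
by rewrite subrr normr0 mul0r.
Qed.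

Lemma bounded_lipschitz_sqrt_clip (R : realType) (N : nat) (m M : R)
    (k : 'I_N) :
  0 < m -> m <= M ->
  bounded_lipschitz (fun x : 'I_N -> R => Num.sqrt (clip m M (x k))).
Proof.
move=> m0 mM; have sm0 : 0 < Num.sqrt m by rewrite sqrtr_gt0.
exists (Num.sqrt M), (2 * Num.sqrt m)^-1; split=> [|||x y e xy].
- exact: sqrtr_ge0.
- by rewrite invr_ge0 mulr_ge0// ltW.
- by move=> x; rewrite ger0_norm ?sqrtr_ge0// ler_wsqrtr// clip_le.
set p := clip m M (x k); set q := clip m M (y k).
have mp : m <= p := ge_clip _ _ _; have mq : m <= q := ge_clip _ _ _.
have pq : p - q = (Num.sqrt p - Num.sqrt q) * (Num.sqrt p + Num.sqrt q).
  by rewrite -subr_sqr !sqr_sqrtr// (le_trans (ltW m0)).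
rewrite mulrC ler_pdivlMr ?mulr_gt0//.
apply: le_trans (le_trans (clip_dist m M _ _) (xy k)).
rewrite -/p -/q pq normrM.
apply: ler_wpM2l => //; rewrite ger0_norm ?addr_ge0 ?sqrtr_ge0//.
by rewrite mulr2n mulrDl mul1r lerD// ler_wsqrtr.
Qed.

Definition truncated_field (R : realType) (N : nat) (m M : R) (x : 'I_N -> R)
  (k : 'I_N) : R :=
  2 * N%:R ^+ 4 * root_field (fun j => Num.sqrt (clip m M (x j))) k.

Lemma truncated_field_lipschitz (R : realType) (N : nat) (m M : R) :
  0 < m -> m <= M -> exists K L : R,
  [/\ 0 < L, sup_lipschitz L (@truncated_field R N m M) &
      forall x k, `|@truncated_field R N m M x k| <= K].
Proof.
move=> m0 mM.
have Gk k : bounded_lipschitz (fun x => @truncated_field R N m M x k).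
  have sq j := @bounded_lipschitz_sqrt_clip R N m M j m0 mM.
  rewrite /truncated_field /root_field /nbr_sum.
  apply: bounded_lipschitzM; first exact: bounded_lipschitz_cst.
  have A j := bounded_lipschitzD (sq (ordS j)) (sq (ord_pred j)).
  apply: bounded_lipschitzD; first exact: bounded_lipschitzM (A k) (A k).
  under eq_fun do rewrite -mulN1r.
  apply: bounded_lipschitzM; first exact: bounded_lipschitz_cst.
  exact: bounded_lipschitzM (sq k) (bounded_lipschitzD (A _) (A _)).
have [K /choice[L KL]] := choice Gk.
have LS k : L k <= \sum_j L j.
  by rewrite (bigD1 k)//= lerDl sumr_ge0// => j _; have [] := KL j.
have KS k : K k <= \sum_j K j.
  by rewrite (bigD1 k)//= lerDl sumr_ge0// => j _; have [] := KL j.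
exists (\sum_k K k), (\sum_k L k + 1); split.
- by rewrite ltr_wpDl// sumr_ge0// => j _; have [] := KL j.
- move=> x y e xy k; have [_ _ _ /(_ x y e xy)] := KL k.
  move=> /le_trans; apply; apply: ler_wpM2r.
    exact: le_trans (normr_ge0 _) (xy k).
  by rewrite (le_trans (LS k))// lerDl.
- by move=> x k; have [_ _ /(_ x) + _] := KL k; move=> /le_trans; apply.
Qed.

(** * Positive solutions *)

(** With mass [N], the components other than [k] contribute at most 1 to the
    entropy, because [ln x <= x - 1]. *)
Lemma sum_ln_le (R : realType) (N : nat) (x : 'I_N -> R) (k : 'I_N) :
  (forall j, 0 < x j) -> \sum_j x j = N%:R -> \sum_j ln (x j) <= ln (x k) + 1.
Proof.
move=> x0 sumx; rewrite (bigD1 k)//= lerD2l.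
apply: (@le_trans _ _ (\sum_(j | j != k) (x j - 1))).
  by apply: ler_sum => j _; exact: ln_le_subr1.
have := congr1 (fun s => s - \sum_(j < N) 1) sumx.
rewrite -sumrB sumr_const card_ord subrr (bigD1 k)//=.
by have := x0 k; lra.
Qed.

(** The solution of the truncated equation has mass [N] and a nondecreasing
    truncated entropy [sum phi (u_j)], initially equal to [ln m + 2].  If
    [u_k < m] at some time, then [phi (u_k) <= ln m + u_k - m] and
    [phi (u_j) <= u_j - 1] for [j != k] bound that entropy by [ln m - m + 1], a
    contradiction; hence the solution never leaves the region where the
    truncation is inactive. *)
Lemma positive_solution (R : realType) (N : nat) (rho0 : 'I_N -> R) :
  (0 < N)%N -> (forall k, 0 < rho0 k) -> \sum_k rho0 k = N%:R ->
  exists u : R -> 'I_N -> R, u 0 = rho0 /\ forall t : R, 0 <= t ->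
    [/\ forall k, 0 < u t k, \sum_k u t k = N%:R &
      forall k, is_derive t 1 (u^~ k)
        (2 * N%:R ^+ 4 * root_field (fun j => Num.sqrt (u t j)) k)].
Proof.
move=> N0 rho0_gt0 sum_rho0.
pose M : R := N%:R; pose m : R := expR (\sum_k ln (rho0 k) - 2).
have m0 : 0 < m by exact: expR_gt0.
have M1 : 1 <= M by rewrite ler1n.
have m_lt k : m < rho0 k.
  rewrite -[ltRHS]lnK ?posrE// ltr_expR.
  by have := sum_ln_le k rho0_gt0 sum_rho0; lra.
have leM (x : 'I_N -> R) : (forall k, 0 < x k) -> \sum_k x k = N%:R ->
    forall k, x k <= M.
  move=> x0 sumx k; rewrite /M -sumx (bigD1 k)//= lerDl.
  by apply: sumr_ge0 => j _; exact: ltW.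
have m1 : m <= 1.
  rewrite -expR0 ler_expR; suff: \sum_k ln (rho0 k) <= 0 by lra.
  apply: (@le_trans _ _ (\sum_k (rho0 k - 1))).
    by apply: ler_sum => k _; exact: ln_le_subr1.
  by rewrite sumrB sum_rho0 sumr_const card_ord subrr.
have mM := le_trans m1 M1.
have [K [L [L0 GL GK]]] := @truncated_field_lipschitz R N m M m0 mM.
have [u [u0 du]] := picard_lindelof rho0 L0 GL.
have mass t : 0 <= t -> \sum_k u t k = N%:R.
  move=> t0; rewrite -sum_rho0 -u0; apply/esym.
  apply: (@is_derive_0_eq _ (fun t => \sum_k u t k)) t0 _ => s /andP[s0 _].
  have dus k := du s k s0.
  have := is_derive_sum dus; rewrite -mulr_sumr sum_root_field mulr0.
  by congr is_derive; apply/funext => r; rewrite fct_sumE.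
have lower t k : 0 <= t -> m <= u t k.
  (* On [0, t] the components stay above a because the field is bounded by K. *)
  move=> t0; pose a := - (`|K| * t) - 1.
  have am : a < m.
    by rewrite (lt_trans _ m0)// /a; have := mulr_ge0 (normr_ge0 K) t0; lra.
  have [phi [dphi phi_ln phi_le phi_lem]] := truncated_log m0 m1 M1 am.
  have ua s j : 0 <= s <= t -> a < u s j.
    move=> /andP[s0 st].
    have : `|u s j - rho0 j| <= `|K| * s.
      apply: (@is_derive_dominated _ (fun s => u s j - rho0 j)
        (fun s => truncated_field m M (u s) j)
        (fun s => `|K| * s) (fun=> `|K|) 0) s0.
      - move=> r r0; rewrite -[truncated_field _ _ _ _]subr0.
        exact: is_deriveB (du r j r0) (is_derive_cst _ r 1).
      - move=> r _; have := is_deriveZ `|K| (is_derive_id r (1 : R)).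
        by rewrite [_ *: _]mulr1.
      - by move=> r _; rewrite (le_trans (GK _ _))// ler_norm.
      - by rewrite u0 subrr normr0 mulr0.
    have : `|K| * s <= `|K| * t by apply: ler_wpM2l.
    by have := rho0_gt0 j; rewrite /a ler_norml; lra.
  have ent : \sum_j phi (u 0 j) <= \sum_j phi (u t j).
    apply: (@ge0_is_derive_le _ (fun t => \sum_j phi (u t j))
      (fun t => \sum_j (clip m M (u t j))^-1 * truncated_field m M (u t) j))
      t0 _ _.
    - move=> s /[dup] /andP[s0 _] st.
      have dus j : is_derive s 1 (fun s => phi (u s j))
          ((clip m M (u s j))^-1 * truncated_field m M (u s) j).
        exact: is_derive1_comp (dphi _ (ua s j st)) (du s j s0).
      have := is_derive_sum dus.
      by congr is_derive; apply/funext => r; rewrite fct_sumE.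
    - move=> s _; rewrite /truncated_field.
      pose b j := Num.sqrt (clip m M (u s j)).
      have clip0 j : 0 < clip m M (u s j) by rewrite (lt_le_trans m0)// ge_clip.
      have -> :
          \sum_j (clip m M (u s j))^-1 * (2 * N%:R ^+ 4 * root_field b j) =
          2 * N%:R ^+ 4 * \sum_j root_field b j / b j ^+ 2.
        rewrite mulr_sumr; apply: eq_bigr => j _.
        by rewrite /b sqr_sqrtr ?ltW// mulrC -!mulrA.
      rewrite mulr_ge0 ?mulr_ge0 ?exprn_ge0// root_field_entropy// => j.
      by rewrite sqrtr_gt0.
  rewrite leNgt; apply/negP => um.
  have phi0 : \sum_j phi (u 0 j) = \sum_j ln (rho0 j).
    by apply: eq_bigr => j _; rewrite u0 phi_ln// ltW//= leM.
  have lnm : ln m = \sum_j ln (rho0 j) - 2 by rewrite expRK.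
  have tt : 0 <= t <= t by rewrite t0 lexx.
  move: ent; rewrite phi0 [leRHS](bigD1 k)//=.
  have := phi_lem (u t k) (ua t k tt) (ltW um).
  have : \sum_(j | j != k) phi (u t j) <= \sum_(j | j != k) (u t j - 1).
    by apply: ler_sum => j _; apply: phi_le; exact: ua.
  have := congr1 (fun s => s - \sum_(j < N) 1) (mass t t0).
  rewrite -sumrB sumr_const card_ord subrr (bigD1 k)//=.
  by rewrite lnm; lra.
exists u; split=> // t t0.
have ut_gt0 k : 0 < u t k by exact: lt_le_trans m0 (lower t k t0).
split=> // [|k]; first exact: mass.
have := du t k t0; rewrite /truncated_field.
by under [fun j : 'I_N => _]eq_fun do rewrite clip_id ?lower//= ?leM ?mass//.
Qed.

Lemma prob_densities_sum (R : realType) (N : nat) (rho : 'rV[R]_N) :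
  (0 < N)%N -> mesh R N * \sum_k rho 0 k = 1 <-> \sum_k rho 0 k = N%:R.
Proof.
move=> N0; have Nn : N%:R != 0 :> R by rewrite pnatr_eq0 -lt0n.
rewrite /mesh; split=> [|->]; last by rewrite mulVf.
by move/(congr1 ( *%R N%:R)); rewrite mulrA divff// mul1r mulr1.
Qed.

Lemma prob_densities_le (R : realType) (N : nat) (rho : 'rV[R]_N) k :
  (0 < N)%N -> prob_densities rho -> 0 <= rho 0 k <= N%:R.
Proof.
move=> N0 [rho0 /(prob_densities_sum _ N0) <-]; rewrite rho0 (bigD1 k)//= lerDl.
exact: sumr_ge0.
Qed.

Lemma is_solution_exists (R : realType) (N : nat) (rho0 : 'rV[R]_N) :
  (0 < N)%N -> pos_prob_densities rho0 -> exists u, is_solution rho0 u.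
Proof.
move=> N0 [[_ /(prob_densities_sum _ N0) sum_rho0] rho0_gt0].
have [u [u0 uP]] := positive_solution N0 rho0_gt0 sum_rho0.
exists (fun t => \row_k u t k); split=> [|t t0|t k t0].
- by apply/rowP => k; rewrite mxE u0.
- have [ut_gt0 sumu _] := uP t t0; split=> [|k]; last by rewrite mxE.
  split=> [k|]; first by rewrite mxE ltW.
  apply/(prob_densities_sum _ N0); rewrite -sumu.
  by apply: eq_bigr => k _; rewrite mxE.
- have [ut_gt0 _ /(_ k) dut] := uP t t0.
  rewrite flow_fieldE => [|j]; last by rewrite mxE ltW.
  have -> : (fun s => (\row_j u s j) 0 k) = u^~ k.
    by apply/funext => s; rewrite mxE.
  have -> : (fun j => Num.sqrt ((\row_j u t j) 0 j)) =
      fun j => Num.sqrt (u t j).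
    by apply/funext => j; rewrite mxE.
  exact: has_deriv_ge0W.
Qed.

(** Replaces the one-sided difference quotients in the definition of a solution
    by derivatives, to which the rules of differentiation apply. *)
Lemma is_solution_extend (R : realType) (N : nat) (rho0 : 'rV[R]_N) u :
  is_solution rho0 u ->
  exists F : 'I_N -> R -> R, forall k (t : R), 0 <= t -> F k t = u t 0 k /\
    is_derive t 1 (F k)
      (2 * N%:R ^+ 4 * root_field (fun j => Num.sqrt (u t 0 j)) k).
Proof.
move=> [_ upos du]; suff /choice[F FP] : forall k, exists Fk : R -> R,
    forall t : R, 0 <= t -> Fk t = u t 0 k /\
    is_derive t 1 Fk
      (2 * N%:R ^+ 4 * root_field (fun j => Num.sqrt (u t 0 j)) k).
  by exists F.
move=> k; have [F FP] := has_deriv_ge0_extend (fun t => du t k).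
exists F => t t0; have [-> dF] := FP t t0; split=> //.
by move: dF; rewrite flow_fieldE// => j; have [[+ _] _] := upos t t0; exact.
Qed.

Lemma is_solution_shift (R : realType) (N : nat) (rho0 : 'rV[R]_N) u (t : R) :
  is_solution rho0 u -> 0 <= t -> is_solution (u t) (fun s => u (s + t)).
Proof.
move=> us t0; have [_ upos du] := us; split=> [|s s0|s k s0].
- by rewrite add0r.
- by apply: upos; exact: addr_ge0.
have [F FP] := has_deriv_ge0_extend (fun t => du t k).
apply: (@has_deriv_ge0_eq _ (fun s => F (s + t))) => // [r r0|].
  by have [] := FP (r + t) (addr_ge0 r0 t0).
apply: has_deriv_ge0W; have [_ dF] := FP (s + t) (addr_ge0 s0 t0).
rewrite -[flow_field _ _ _]mulr1.
apply: (@is_derive1_comp _ F (fun s => s + t)) => //.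
have := is_deriveD (is_derive_id s (1 : R)) (is_derive_cst t s 1).
by rewrite addr0.
Qed.

Lemma is_solution_eq (R : realType) (N : nat) (rho0 : 'rV[R]_N) u v :
  (forall t, 0 <= t -> u t = v t) -> is_solution rho0 u -> is_solution rho0 v.
Proof.
move=> uv [u0 upos du]; split=> [|t t0|t k t0]; first by rewrite -uv.
  by rewrite -uv//; exact: upos.
rewrite -uv//.
apply: (@has_deriv_ge0_eq _ (fun s => u s 0 k)) (du t k t0) => //.
by move=> s s0; rewrite uv.
Qed.

(** * Contraction of the Hellinger distance *)

Lemma hellinger_affinity_ndecr (R : realType) (N : nat)
    (rho0 eta0 : 'rV[R]_N) u v (t : R) :
  is_solution rho0 u -> is_solution eta0 v -> 0 <= t ->
  \sum_k Num.sqrt (rho0 0 k) * Num.sqrt (eta0 0 k) <=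
  \sum_k Num.sqrt (u t 0 k) * Num.sqrt (v t 0 k).
Proof.
move=> us vs t0; have [F FP] := is_solution_extend us.
have [G GP] := is_solution_extend vs.
have [<- upos _] := us; have [<- vpos _] := vs.
pose a s j := Num.sqrt (u s 0 j); pose b s j := Num.sqrt (v s 0 j).
have a0 s j : 0 <= s -> 0 < a s j.
  by move=> s0; rewrite sqrtr_gt0; have [_] := upos s s0; exact.
have b0 s j : 0 <= s -> 0 < b s j.
  by move=> s0; rewrite sqrtr_gt0; have [_] := vpos s s0; exact.
have FGE s : 0 <= s ->
    \sum_k Num.sqrt (F k s) * Num.sqrt (G k s) = \sum_k a s k * b s k.
  move=> s0; apply: eq_bigr => k _.
  by have [-> _] := FP k s s0; have [-> _] := GP k s s0.
rewrite -!FGE//.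
apply: (@ge0_is_derive_le _
  (fun s => \sum_k Num.sqrt (F k s) * Num.sqrt (G k s))
  (fun s => N%:R ^+ 4 * \sum_k (root_field (a s) k / a s k * b s k +
                                root_field (b s) k / b s k * a s k)))
  t0 _ _ => s /andP[s0 _]; last first.
  rewrite mulr_ge0 ?exprn_ge0// root_field_hellinger// => k.
    by apply: a0; exact: ltW.
  by apply: b0; exact: ltW.
have dFG k : is_derive s 1 (fun s => Num.sqrt (F k s) * Num.sqrt (G k s))
    (N%:R ^+ 4 * (root_field (a s) k / a s k * b s k +
                  root_field (b s) k / b s k * a s k)).
  have sqrt_comp (H : R -> R) h dh : 0 < h -> H s = h -> is_derive s 1 H dh ->
      is_derive s 1 (fun s => Num.sqrt (H s)) ((2 * Num.sqrt h)^-1 * dh).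
    move=> h0 Hh dH; apply: is_derive1_comp => //.
    by rewrite Hh; exact: is_derive1_sqrt.
  have [Fk dF] := FP k s s0; have [Gk dG] := GP k s s0.
  have u_gt0 : 0 < u s 0 k by have [_] := upos s s0; exact.
  have v_gt0 : 0 < v s 0 k by have [_] := vpos s s0; exact.
  have := is_deriveM (sqrt_comp _ _ _ u_gt0 Fk dF)
    (sqrt_comp _ _ _ v_gt0 Gk dG).
  rewrite Fk Gk -/(a s k) -/(b s k) -/(a s) -/(b s).
  congr is_derive; rewrite ![_ *: _]mulrC.
  have := a0 s k s0; have := b0 s k s0 => ? ?.
  by field; rewrite !gt_eqF.
have := is_derive_sum dFG; rewrite -mulr_sumr.
by congr is_derive; apply/funext => r; rewrite fct_sumE.
Qed.

(** The squared Hellinger distance [sum (sqrt x - sqrt y)^2] equals [2 N] minus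
    twice the affinity, hence does not increase.  Initially it is at most
    [N e], since [(sqrt x - sqrt y)^2 <= |x - y|]; and it controls
    [x - y = (sqrt x - sqrt y) (sqrt x + sqrt y)] because densities are
    bounded by [N]. *)
Lemma solution_dist (R : realType) (N : nat) (rho0 eta0 : 'rV[R]_N) u v
    (e t : R) k :
  (0 < N)%N -> is_solution rho0 u -> is_solution eta0 v ->
  (forall j, `|rho0 0 j - eta0 0 j| <= e) -> 0 <= t ->
  `|u t 0 k - v t 0 k| <= 2 * N%:R * Num.sqrt e.
Proof.
move=> N0 us vs re t0.
have e0 : 0 <= e := le_trans (normr_ge0 _) (re k).
have := hellinger_affinity_ndecr us vs t0.
have [u0 upos _] := us; have [v0 vpos _] := vs.
have hellingerE (x y : 'rV[R]_N) : prob_densities x -> prob_densities y ->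
    \sum_j (Num.sqrt (x 0 j) - Num.sqrt (y 0 j)) ^+ 2 =
    2 * N%:R - 2 * \sum_j Num.sqrt (x 0 j) * Num.sqrt (y 0 j).
  move=> [x0 /(prob_densities_sum _ N0) sx] [y0 /(prob_densities_sum _ N0) sy].
  transitivity (\sum_j x 0 j + \sum_j y 0 j -
      2 * \sum_j Num.sqrt (x 0 j) * Num.sqrt (y 0 j)).
    rewrite mulr_sumr -sumrN -!big_split/=; apply: eq_bigr => j _.
    by rewrite -{2}(sqr_sqrtr (x0 j)) -{2}(sqr_sqrtr (y0 j)); ring.
  by rewrite sx sy; ring.
have [[ut _] [vt _]] := (upos t t0, vpos t t0).
have [[r0 _] [h0 _]] := (upos 0 (lexx 0), vpos 0 (lexx 0)).
rewrite u0 in r0; rewrite v0 in h0.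
move=> aff.
have {aff} : \sum_j (Num.sqrt (u t 0 j) - Num.sqrt (v t 0 j)) ^+ 2 <=
    \sum_j (Num.sqrt (rho0 0 j) - Num.sqrt (eta0 0 j)) ^+ 2.
  by rewrite !hellingerE//; lra.
set p := Num.sqrt (u t 0 k); set q := Num.sqrt (v t 0 k).
have pq_le : (p - q) ^+ 2 <=
    \sum_j (Num.sqrt (u t 0 j) - Num.sqrt (v t 0 j)) ^+ 2.
  by rewrite (bigD1 k)//= lerDl; apply: sumr_ge0 => j _; exact: sqr_ge0.
move=> /(le_trans pq_le) {}pq_le.
have {pq_le} : (p - q) ^+ 2 <= N%:R * e.
  apply: le_trans pq_le _.
  rewrite mulr_natl -[X in _ *+ X](card_ord N) -sumr_const.
  apply: ler_sum => j _; apply: le_trans (re j).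
  have [[/(_ j) r_ge0 _] [/(_ j) h_ge0 _]] := (r0, h0).
  rewrite -{2}(sqr_sqrtr r_ge0) -{2}(sqr_sqrtr h_ge0) subr_sqr normrM.
  rewrite -real_normK ?num_real// expr2 ler_wpM2l//.
  rewrite ler_norml ger0_norm ?addr_ge0 ?sqrtr_ge0//.
  by have := sqrtr_ge0 (rho0 0 j); have := sqrtr_ge0 (eta0 0 j); lra.
have /andP[uk0 ukN] := prob_densities_le k N0 ut.
have /andP[vk0 vkN] := prob_densities_le k N0 vt.
rewrite -(sqr_sqrtr uk0) -(sqr_sqrtr vk0) -/p -/q subr_sqr normrM => pq.
have pN : p <= Num.sqrt N%:R by rewrite ler_wsqrtr.
have qN : q <= Num.sqrt N%:R by rewrite ler_wsqrtr.
have -> : 2 * N%:R * Num.sqrt e = Num.sqrt (N%:R * e) * (2 * Num.sqrt N%:R).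
  by rewrite sqrtrM// -{1}(@sqr_sqrtr _ N%:R)//; ring.
apply: ler_pM => //.
  by rewrite -sqrtr_sqr ler_wsqrtr.
by rewrite ger0_norm ?addr_ge0 ?sqrtr_ge0//; lra.
Qed.

Lemma is_solution_unique (R : realType) (N : nat) (rho0 : 'rV[R]_N) u v :
  (0 < N)%N -> is_solution rho0 u -> is_solution rho0 v ->
  forall t, 0 <= t -> v t = u t.
Proof.
move=> N0 us vs t t0; apply/rowP => k; apply/eqP; rewrite -subr_eq0 -normr_le0.
rewrite (le_trans (solution_dist k (e := 0) N0 vs us _ t0)) ?sqrtr0 ?mulr0//.
by move=> j; rewrite subrr normr0.
Qed.

(** The square root of a density lies in [[0, sqrt N]], so the field is bounded
    on the densities. *)
Lemma solution_lipschitz (R : realType) (N : nat) (rho0 : 'rV[R]_N) u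
    (s t : R) k :
  (0 < N)%N -> is_solution rho0 u -> 0 <= s -> 0 <= t ->
  `|u t 0 k - u s 0 k| <= 16 * N%:R ^+ 5 * `|t - s|.
Proof.
move=> N0 us; wlog st : s t / s <= t.
  move=> H s0 t0; have [|/ltW ts] := leP s t; first by move=> ?; exact: H.
  by rewrite distrC [`|t - s|]distrC; exact: H.
move=> s0 t0; have [F FP] := is_solution_extend us; have [_ upos _] := us.
have [[<- _] [<- _]] := (FP k t t0, FP k s s0).
rewrite (ger0_norm (_ : 0 <= t - s)) ?subr_ge0//.
apply: (@is_derive_dominated _ (fun t => F k t - F k s)
  (fun t => 2 * N%:R ^+ 4 * root_field (fun j => Num.sqrt (u t 0 j)) k)
  (fun t => 16 * N%:R ^+ 5 * (t - s)) (fun=> 16 * N%:R ^+ 5) s) st.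
- move=> r sr; have [_ dF] := FP k r (le_trans s0 sr).
  rewrite -[X in is_derive _ _ _ X]subr0.
  exact: is_deriveB dF (is_derive_cst _ r 1).
- move=> r _; have := is_deriveZ (16 * N%:R ^+ 5)
    (is_deriveB (is_derive_id r (1 : R)) (is_derive_cst s r 1)).
  by rewrite subr0 [_ *: 1]mulr1.
- move=> r sr; have [ur _] := upos r (le_trans s0 (ltW sr)).
  pose c : R := Num.sqrt N%:R; pose a j := Num.sqrt (u r 0 j).
  have ac j : 0 <= a j <= c.
    rewrite sqrtr_ge0 ler_wsqrtr//.
    by have /andP[] := prob_densities_le j N0 ur.
  have Ac j : 0 <= nbr_sum a j <= 2 * c.
    by have := ac (ordS j); have := ac (ord_pred j); rewrite /nbr_sum; lra.
  have AAc : 0 <= nbr_sum (nbr_sum a) k <= 4 * c.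
    by have := Ac (ordS k); have := Ac (ord_pred k); rewrite /nbr_sum; lra.
  have cc : c * c = N%:R by rewrite -expr2 sqr_sqrtr.
  have -> : 16 * N%:R ^+ 5 = 2 * N%:R ^+ 4 * (4 * (c * c) + c * (4 * c)) :> R.
    by rewrite [c * (4 * c)]mulrCA cc; ring.
  rewrite normrM (ger0_norm (_ : 0 <= 2 * N%:R ^+ 4)) ?mulr_ge0 ?exprn_ge0//.
  apply: ler_wpM2l; first by rewrite mulr_ge0 ?exprn_ge0.
  rewrite (le_trans (ler_normB _ _))// lerD//.
    have -> : 4 * (c * c) = (2 * c) ^+ 2 by ring.
    have /andP[A0 Ac2] := Ac k; rewrite ger0_norm ?sqr_ge0//.
    by rewrite lerXn2r// nnegrE (le_trans A0).
  have /andP[a0 ak] := ac k; have /andP[AA0 AA] := AAc.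
  by rewrite ger0_norm ?mulr_ge0// ler_pM.
- by rewrite !subrr normr0 mulr0.
Qed.

(** * Extension to the boundary *)

Lemma row_cvgP (R : realType) (N : nat) (T : Type) (F : set_system T)
    (f : T -> 'rV[R]_N) (l : 'rV[R]_N) : Filter F ->
  f @ F --> l <-> forall k, f x 0 k @[x --> F] --> l 0 k.
Proof.
move=> FF; split=> [fl k|fl].
  apply: (cvg_comp _ (fun v : 'rV[R]_N => v 0 k) fl).
  exact: coord_continuous.
apply/cvgrPdist_le => e e0.
have : \forall x \near F, forall k, `|l 0 k - f x 0 k| <= e.
  suff: forall k, \forall x \near F, `|l 0 k - f x 0 k| <= e.
    exact: filter_forall.
  by move=> k; have /cvgrPdist_le := fl k; apply.
apply: filterS => x lf; rewrite /Num.norm/= mx_normrE.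
by apply: bigmax_le => [|[i j] _]; [exact: ltW|rewrite !mxE/= ord1].
Qed.

Lemma le_harmonic (R : realType) (x y c : R) :
  (forall n, x <= y + c * harmonic n) -> x <= y.
Proof.
move=> xy; have ch : y + c * harmonic n @[n --> \oo] --> y.
  rewrite -[X in _ --> X]addr0 -[X in _ + X](mulr0 c).
  apply: cvgD; first exact: cvg_cst.
  by apply: cvgM; [exact: cvg_cst|exact: cvg_harmonic].
rewrite leNgt; apply/negP => yx; have /cvgrPdist_lt/(_ (x - y)) := ch.
rewrite subr_gt0 => /(_ yx)[n _ /(_ n (leqnn n))]; have := xy n.
by rewrite ltr_norml; lra.
Qed.

(** The weight is the square of [1 / (n + 1)] so that the square root in
    [solution_dist] turns it into the rate [1 / (n + 1)]. *)
Definition blend (R : realType) (N : nat) (n : nat) (rho : 'rV[R]_N) :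
    'rV[R]_N :=
  \row_k ((1 - harmonic n ^+ 2) * rho 0 k + harmonic n ^+ 2).

Lemma harmonic_sq_le1 (R : realType) n : (harmonic n : R) ^+ 2 <= 1.
Proof. by rewrite expr_le1 ?harmonic_ge0// /harmonic/= invf_le1// ler1n. Qed.

Lemma blend_pos (R : realType) (N n : nat) (rho : 'rV[R]_N) :
  (0 < N)%N -> prob_densities rho -> pos_prob_densities (blend n rho).
Proof.
move=> N0 [rho0 /(prob_densities_sum _ N0) sum_rho].
have gt0 k : 0 < blend n rho 0 k.
  rewrite mxE ltr_wpDl ?exprn_gt0 ?harmonic_gt0//.
  by rewrite mulr_ge0// subr_ge0 harmonic_sq_le1.
split=> //; split=> [k|]; first exact: ltW.
apply/(prob_densities_sum _ N0); under eq_bigr do rewrite mxE.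
rewrite big_split/= -mulr_sumr sum_rho sumr_const card_ord -mulr_natr; ring.
Qed.

Lemma blend_dist (R : realType) (N n m : nat) (rho : 'rV[R]_N) k :
  (0 < N)%N -> prob_densities rho -> (n <= m)%N ->
  `|blend m rho 0 k - blend n rho 0 k| <= N%:R * harmonic n ^+ 2.
Proof.
move=> N0 Drho nm; have /andP[r0 rN] := prob_densities_le k N0 Drho.
have N1 : 1 <= N%:R :> R by rewrite ler1n.
rewrite !mxE; set a : R := harmonic n ^+ 2; set b : R := harmonic m ^+ 2.
have -> : (1 - b) * rho 0 k + b - ((1 - a) * rho 0 k + a) =
    (rho 0 k - 1) * (a - b) by ring.
have ba : b <= a.
  rewrite lerXn2r ?nnegrE ?harmonic_ge0// /harmonic/=.
  by rewrite lef_pV2 ?posrE// ler_nat.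
rewrite normrM; apply: ler_pM => //; first by rewrite ler_norml; lra.
by rewrite ger0_norm ?subr_ge0// gerBl sqr_ge0.
Qed.

Lemma blend_dist_self (R : realType) (N n : nat) (rho : 'rV[R]_N) k :
  (0 < N)%N -> prob_densities rho ->
  `|rho 0 k - blend n rho 0 k| <= N%:R * harmonic n ^+ 2.
Proof.
move=> N0 Drho; have /andP[r0 rN] := prob_densities_le k N0 Drho.
have N1 : 1 <= N%:R :> R by rewrite ler1n.
rewrite !mxE; set a : R := harmonic n ^+ 2.
have -> : rho 0 k - ((1 - a) * rho 0 k + a) = (rho 0 k - 1) * a by ring.
rewrite normrM [`|a|]ger0_norm ?sqr_ge0// ler_wpM2r ?sqr_ge0//.
by rewrite ler_norml; lra.
Qed.

Lemma blend_contract (R : realType) (N n : nat) (rho eta : 'rV[R]_N) k :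
  `|blend n rho 0 k - blend n eta 0 k| <= `|rho 0 k - eta 0 k|.
Proof.
rewrite !mxE; set a : R := harmonic n ^+ 2.
have -> : (1 - a) * rho 0 k + a - ((1 - a) * eta 0 k + a) =
    (1 - a) * (rho 0 k - eta 0 k) by ring.
rewrite normrM ler_piMl// ger0_norm ?subr_ge0 ?harmonic_sq_le1//.
by rewrite gerBl sqr_ge0.
Qed.

Lemma blend_cvg (R : realType) (N : nat) (rho : 'rV[R]_N) :
  (0 < N)%N -> prob_densities rho ->
  blend n rho @[n --> \oo] --> within (@prob_densities R N) (nbhs rho).
Proof.
move=> N0 Drho.
have cv : blend n rho @[n --> \oo] --> rho.
  apply/row_cvgP => k; apply/cvgrPdist_le => e e0.
  have hn : N%:R * harmonic n ^+ 2 @[n --> \oo] --> (0 : R).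
    rewrite -(mulr0 N%:R) -(mulr0 0); apply: cvgM; first exact: cvg_cst.
    by apply: cvgM; exact: cvg_harmonic.
  have /cvgrPdist_le/(_ e e0) := hn; apply: filterS => n.
  rewrite sub0r normrN => /(le_trans (ler_norm _)); apply: le_trans.
  exact: blend_dist_self.
move=> P DP; have : \forall n \near \oo, prob_densities (blend n rho) ->
    P (blend n rho) := cv _ DP.
by apply: filterS => n; apply; have [] := blend_pos n N0 Drho.
Qed.

(** Positive densities are dense: every density is the limit of its blends. *)
Lemma dense_eq (R : realType) (N : nat) (f g : 'rV[R]_N -> 'rV[R]_N) :
  (0 < N)%N ->
  {within @prob_densities R N, continuous f} ->
  {within @prob_densities R N, continuous g} ->
  (forall rho, pos_prob_densities rho -> f rho = g rho) ->
  forall rho, prob_densities rho -> f rho = g rho.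
Proof.
move=> N0 /subspace_continuousP cf /subspace_continuousP cg fg rho Drho.
have bf := cvg_comp _ _ (blend_cvg N0 Drho) (cf rho Drho).
have bg := cvg_comp _ _ (blend_cvg N0 Drho) (cg rho Drho).
apply: (cvg_unique _ bf); first exact: norm_hausdorff.
suff -> : f \o (fun n => blend n rho) = g \o (fun n => blend n rho) by [].
by apply/funext => n /=; apply: fg; exact: blend_pos.
Qed.

(** The blends of [rho] form a Cauchy sequence whose rate is uniform in time
    after it has been transported by the flow; the modulus of continuity of
    the flow passes to the limit. *)
Lemma flow_extension (R : realType) (N : nat) : (0 < N)%N ->
  exists S : R -> 'rV[R]_N -> 'rV[R]_N,
  [/\ extends_flow S,
      forall t rho, 0 <= t -> prob_densities rho -> prob_densities (S t rho) &
      forall (s t e : R) (rho eta : 'rV[R]_N) k, 0 <= s -> 0 <= t ->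
        prob_densities rho -> prob_densities eta ->
        (forall j, `|rho 0 j - eta 0 j| <= e) ->
        `|S s rho 0 k - S t eta 0 k| <=
          16 * N%:R ^+ 5 * `|s - t| + 2 * N%:R * Num.sqrt e].
Proof.
move=> N0; pose D := @prob_densities R N.
pose C : R := 2 * N%:R * Num.sqrt N%:R.
have /choice[Phi PhiP] : forall rho : 'rV[R]_N, exists u,
    pos_prob_densities rho -> is_solution rho u.
  move=> rho; have [rho_pos|] := pselect (pos_prob_densities rho).
    have [u us] := is_solution_exists N0 rho_pos.
    by exists u.
  by exists (fun=> 0).
have solP n rho : D rho -> is_solution (blend n rho) (Phi (blend n rho)).
  by move=> Drho; apply: PhiP; exact: blend_pos.
have rateE n :
    2 * N%:R * Num.sqrt (N%:R * harmonic n ^+ 2) = C * harmonic n :> R.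
  by rewrite sqrtrM// sqrtr_sqr ger0_norm ?harmonic_ge0// mulrA.
have /choice[S SP] : forall trho : R * 'rV[R]_N, exists l : 'rV[R]_N,
    0 <= trho.1 -> D trho.2 -> forall n k,
    `|l 0 k - Phi (blend n trho.2) trho.1 0 k| <= C * harmonic n.
  move=> [t rho]/=; have [[t0 Drho]|H] := pselect (0 <= t /\ D rho); last first.
    by exists 0 => ? ?; case: H.
  suff /choice[l lP] : forall k, exists l : R, forall n,
      `|l - Phi (blend n rho) t 0 k| <= C * harmonic n.
    by exists (\row_k l k) => _ _ n k; rewrite mxE.
  move=> k; apply: (@cauchy_rate _ (fun n => Phi (blend n rho) t 0 k)).
    rewrite -(mulr0 C); apply: cvgM; [exact: cvg_cst|exact: cvg_harmonic].
  move=> n m nm; rewrite -rateE.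
  apply: (solution_dist k N0 (solP m rho Drho) (solP n rho Drho)) => // j.
  exact: blend_dist.
have Sn t rho n k : 0 <= t -> D rho ->
    `|S (t, rho) 0 k - Phi (blend n rho) t 0 k| <= C * harmonic n.
  by move=> t0 Drho; exact: (SP (t, rho)).
exists (fun t rho => S (t, rho)); split=> [rho rho_pos|t rho t0 Drho|].
- have [Drho _] := rho_pos; apply: is_solution_eq (PhiP rho rho_pos) => t t0.
  apply/rowP => k; apply/esym/eqP; rewrite -subr_eq0 -normr_le0.
  apply: (@le_harmonic _ _ _ (C + C)) => n; rewrite add0r mulrDl.
  rewrite (le_trans (ler_distD (Phi (blend n rho) t 0 k) _ _))// lerD ?Sn//.
  rewrite -rateE distrC.
  apply: (solution_dist k N0 (PhiP _ rho_pos) (solP n rho Drho)) => // j.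
  exact: blend_dist_self.
- have Dn n : D (Phi (blend n rho) t).
    by have [_ /(_ t t0)[]] := solP n rho Drho.
  split=> [k|].
    apply: (@le_harmonic _ _ _ C) => n; have [/(_ k) + _] := Dn n.
    by have := Sn t rho n k t0 Drho; rewrite ler_norml; lra.
  apply/(prob_densities_sum _ N0)/eqP; rewrite -subr_eq0 -normr_le0.
  apply: (@le_harmonic _ _ _ (N%:R * C)) => n; rewrite add0r.
  have [_ /(prob_densities_sum _ N0) sum_n] := Dn n.
  rewrite -[X in _ - X]sum_n -sumrB (le_trans (ler_norm_sum _ _ _))//.
  rewrite -mulrA mulr_natl.
  rewrite -[X in _ *+ X](card_ord N) -sumr_const.
  by apply: ler_sum => k _; exact: Sn.
- move=> s t e rho eta k s0 t0 Drho Deta re.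
  apply: (@le_harmonic _ _ _ (C + C)) => n.
  have rn : `|Phi (blend n rho) s 0 k - Phi (blend n eta) s 0 k| <=
      2 * N%:R * Num.sqrt e.
    apply: (solution_dist k N0 (solP n rho Drho) (solP n eta Deta)) => // j.
    exact: le_trans (blend_contract _ _ _ _) (re j).
  have st := solution_lipschitz k N0 (solP n eta Deta) t0 s0.
  have := Sn s rho n k s0 Drho; have := Sn t eta n k t0 Deta.
  move: rn st; rewrite !ler_norml mulrDl.
  set a := Phi _ _ _ _; set b := Phi _ _ _ _; set c := Phi _ _ _ _.
  set d := _ * `|_|; move=> /andP[? ?] /andP[? ?] /andP[? ?] /andP[? ?].
  by apply/andP; split; lra.
Qed.

Theorem proposition15 (R : realType) (N : nat) (hN : (0 < N)%N) :
  (forall rho0 : 'rV[R]_N, pos_prob_densities rho0 ->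
     exists u : R -> 'rV[R]_N, is_solution rho0 u /\
       forall v : R -> 'rV[R]_N, is_solution rho0 v ->
         forall t : R, 0 <= t -> v t = u t) /\
  (exists S : R -> 'rV[R]_N -> 'rV[R]_N,
     [/\ continuous_semigroup (@prob_densities R N) S,
         extends_flow S
       & forall S' : R -> 'rV[R]_N -> 'rV[R]_N,
           continuous_semigroup (@prob_densities R N) S' ->
           extends_flow S' ->
           forall (t : R) (rho : 'rV[R]_N), 0 <= t -> prob_densities rho ->
             S' t rho = S t rho]).
Proof.
split=> [rho0 /(is_solution_exists hN)[u us]|].
  by exists u; split=> // v vs t t0; exact: is_solution_unique us vs t t0.
have slice (T : R -> 'rV[R]_N -> 'rV[R]_N) t : 0 <= t ->
    {within [set p : R * 'rV[R]_N | 0 <= p.1 /\ prob_densities p.2],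
      continuous (fun p : R * 'rV[R]_N => T p.1 p.2)} ->
    {within @prob_densities R N, continuous (T t)}.
  move=> t0 /subspace_continuousP cT; apply/subspace_continuousP => rho Drho.
  have ct := cT (t, rho) (conj t0 Drho).
  apply: (cvg_comp (fun x => (t, x)) (fun p => T p.1 p.2) _ ct).
  move=> P [[Q1 Q2] /= [Q1t Q2rho] QP].
  rewrite /within/=; apply: filterS Q2rho => x Q2x Dx.
  by apply: (QP (t, x)) => //; split=> //=; exact: nbhs_singleton.
have [S [ext SD Sdist]] := flow_extension R hN; exists S.
have cS : {within [set p : R * 'rV[R]_N | 0 <= p.1 /\ prob_densities p.2],
    continuous (fun p : R * 'rV[R]_N => S p.1 p.2)}.
  apply/subspace_continuousP => -[t rho] [/= t0 Drho].
  apply/row_cvgP => k; apply/cvgrPdist_le => e e0.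
  have N0 : 0 < N%:R :> R by rewrite ltr0n.
  have K0 : 0 < 16 * N%:R ^+ 5 :> R by rewrite mulr_gt0 ?exprn_gt0.
  have near_t : \forall p \near (t, rho),
      `|t - p.1| <= e / 2 / (16 * N%:R ^+ 5).
    have : (p.1 : R) @[p --> (t, rho)] --> t by exact: cvg_fst.
    by move=> /cvgrPdist_le; apply; rewrite !divr_gt0.
  have near_rho : \forall p \near (t, rho), forall j,
      `|rho 0 j - (p.2 : 'rV[R]_N) 0 j| <= (e / (4 * N%:R)) ^+ 2.
    have near_rhoj j : \forall p \near (t, rho),
        `|rho 0 j - (p.2 : 'rV[R]_N) 0 j| <= (e / (4 * N%:R)) ^+ 2.
      have : (p.2 : 'rV[R]_N) 0 j @[p --> (t, rho)] --> rho 0 j.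
        by move: j; apply/row_cvgP; exact: cvg_snd.
      by move=> /cvgrPdist_le; apply; rewrite exprn_gt0// divr_gt0// mulr_gt0.
    exact: filter_forall near_rhoj.
  rewrite near_withinE.
  apply: filterS2 near_t near_rho => -[s eta]/= ts re [s0 Deta].
  apply: le_trans (Sdist t s _ rho eta k t0 s0 Drho Deta re) _.
  have time_le : 16 * N%:R ^+ 5 * `|t - s| <= e / 2.
    by rewrite mulrC -ler_pdivlMr.
  have space_le : 2 * N%:R * Num.sqrt ((e / (4 * N%:R)) ^+ 2) = e / 2.
    rewrite sqrtr_sqr ger0_norm; first by field; rewrite gt_eqF.
    by rewrite divr_ge0 ?mulr_ge0 ?ltW.
  by rewrite space_le; lra.
split=> // [|S' [_ _ _ cS'] ext' t rho t0].
- split=> //.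
  + apply: (@dense_eq _ _ (S 0) id hN (slice S 0 (lexx 0) cS));
      last by move=> rho /ext[].
    by apply: continuous_subspaceT => rho; exact: cvg_id.
  + move=> s t rho s0 t0.
    apply: (@dense_eq _ _ (S (s + t)) (S s \o S t) hN
      (slice S _ (addr_ge0 s0 t0) cS)) => [|{}rho rho_pos].
      apply/subspace_continuousP => rho' Drho'.
      have /subspace_continuousP/(_ rho' Drho') cSt := slice S t t0 cS.
      have /subspace_continuousP/(_ _ (SD _ _ t0 Drho')) cSs := slice S s s0 cS.
      apply: (cvg_comp (S t) (S s) _ cSs) => P DP.
      have : \forall x \near within (@prob_densities R N) (nbhs rho'),
          prob_densities (S t x) -> P (S t x) := cSt _ DP.
      rewrite !near_withinE; apply: filterS => x SP Dx.
      by apply: SP => //; exact: SD.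
    have Sst := is_solution_shift (ext rho rho_pos) t0.
    have Stpos : pos_prob_densities (S t rho).
      by have [_ /(_ t t0)] := ext rho rho_pos.
    exact: (is_solution_unique hN (ext _ Stpos) Sst s0).
- apply: (@dense_eq _ _ (S' t) (S t) hN (slice S' t t0 cS')
    (slice S t t0 cS)) => {}rho rho_pos.
  exact: (is_solution_unique hN (ext _ rho_pos) (ext' _ rho_pos)).
Qed.
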